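(* Let $0<L_0\le\infty$, $0<\delta<1$, $\tau>0$ with $\tau\le\delta L_0/\sqrt M$, and $\beta>0$. Assume that $\Lambda\subseteq\mathbb R^M$ contains the ball $\{\lambda\in\mathbb R^M:\|\lambda\|\le L_0\}$ (so $\Lambda=\mathbb R^M$ if $L_0=\infty$). Let $\pi(d\lambda)=q(\lambda)\,d\lambda$, and let $\hat f_n$ be any estimator of $f$ (not necessarily an exponentially weighted aggregate) satisfying $$E\big(\|\hat f_n-f\|_n^2\big)\le\int_\Lambda\|f_\lambda-f\|_n^2\,p(d\lambda)+\frac{\beta\,\mathcal K(p,\pi)}{n}\qquad\text{for all probability measures }p\text{ on }\Lambda.$$ Then for all $\lambda^*\in\mathbb R^M$ such that $\|\lambda^*\|\le(1-\delta)L_0$ we have $$E\big(\|\hat f_n-f\|_n^2\big)\le\|f_{\lambda^*}-f\|_n^2+\frac{4\beta}{n}\sum_{j\in J(\lambda^* )}\log(1+\tau^{-1}|\lambda_j^*|)+R(M,\tau,L_0,\delta),$$ where $$R(M,\tau,L_0,\delta)=\tau^2e^{2\tau^3M^{5/2}(\delta L_0)^{-3}}\sum_{j=1}^M\|\phi_j\|_n^2+\frac{2\beta\tau^3M^{5/2}}{n\delta^3L_0^3}$$ for $L_0<\infty$, and $R(M,\tau,\infty,\delta)=\tau^2\sum_{j=1}^M\|\phi_j\|_n^2$.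
   Context: Model: $Y_i=f(x_i)+\xi_i$, $i=1,\dots,n$, where $x_1,\dots,x_n$ are non-random elements of a set $\mathcal X$, $f:\mathcal X\to\mathbb R$ is an unknown function, and $\xi_1,\dots,\xi_n$ are i.i.d. zero-mean real random variables; an estimator $\hat f_n$ is a random function on $\mathcal X$ depending on the data $(x_i,Y_i)_{i\le n}$. Functions $\phi_1,\dots,\phi_M:\mathcal X\to\mathbb R$ are given, and $f_\lambda=\sum_{j=1}^M\lambda_j\phi_j$ for $\lambda=(\lambda_1,\dots,\lambda_M)\in\mathbb R^M$. For a function $g$ on $\mathcal X$, $\|g\|_n^2=\frac1n\sum_{i=1}^ng(x_i)^2$. $\|\lambda\|$ is the Euclidean norm on $\mathbb R^M$ and $J(\lambda)=\{j:\lambda_j\ne0\}$. Sparsity prior density: $q_0(t)=\frac{3}{2(1+|t|)^4}$ for $t\in\mathbb R$, and $$q(\lambda)=\frac1{C_0}\prod_{j=1}^M\tau^{-1}q_0(\lambda_j/\tau)\,\mathbf 1(\|\lambda\|\le L_0),\qquad\lambda\in\mathbb R^M,$$ where $C_0=C_0(\tau,M,L_0)$ is the normalizing constant making $q$ a probability density (when $L_0=\infty$ the indicator is identically $1$ and $C_0=1$). $\mathcal K(p,\pi)$ is the Kullback–Leibler divergence, $\mathcal K(p,\pi)=\int\log\frac{dp}{d\pi}\,dp$ if $p\ll\pi$ and $+\infty$ otherwise. *)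

(* Defs.v *)
From HB Require Import structures.
From mathcomp Require Export all_boot all_order all_algebra.
From mathcomp Require Export all_classical all_reals all_analysis.

Set Implicit Arguments.
Unset Strict Implicit.
Unset Printing Implicit Defensive.

Export Order.TTheory GRing.Theory Num.Theory.
Export numFieldNormedType.Exports.

Local Open Scope classical_set_scope.
Local Open Scope ring_scope.

Section lebesgue_tuple_step.
Context {R : realType} {n : nat}.
Variable m : {sigma_finite_measure set (n.-tuple R) -> \bar R}.

Definition tuple_cons (p : R * n.-tuple R) : n.+1.-tuple R :=
  [tuple of p.1 :: p.2].

Lemma measurable_tuple_cons : measurable_fun [set: R * n.-tuple R] tuple_cons.
Proof. exact: (@measurable_cons _ _ _ _ fst n snd). Qed.

Lemma measurable_tuple_cons_preimage (A : set (n.+1.-tuple R)) :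
  measurable A -> measurable (tuple_cons @^-1` A).
Proof.
by move=> mA; rewrite -[X in measurable X]setTI; exact: measurable_tuple_cons.
Qed.

Definition lebesgue_cons : set (n.+1.-tuple R) -> \bar R :=
  pushforward (@lebesgue_measure R \x m)%E tuple_cons.

Let lebesgue_cons0 : lebesgue_cons set0 = 0%E.
Proof. by rewrite /lebesgue_cons /pushforward preimage_set0 measure0. Qed.

Let lebesgue_cons_ge0 A : (0 <= lebesgue_cons A)%E.
Proof. by rewrite /lebesgue_cons /pushforward measure_ge0. Qed.

Let lebesgue_cons_sigma_additive : semi_sigma_additive lebesgue_cons.
Proof.
move=> F mF tF mUF; rewrite /lebesgue_cons /pushforward preimage_bigcup.
apply: measure_semi_sigma_additive.
- by move=> k; exact: measurable_tuple_cons_preimage.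
- apply/trivIsetP => /= i j _ _ ij; rewrite -preimage_setI.
  by move/trivIsetP : tF => /(_ _ _ _ _ ij) ->//; rewrite preimage_set0.
- by rewrite -preimage_bigcup; exact: measurable_tuple_cons_preimage.
Qed.

HB.instance Definition _ := isMeasure.Build _ _ _ lebesgue_cons
  lebesgue_cons0 lebesgue_cons_ge0 lebesgue_cons_sigma_additive.

Let lebesgue_cons_sigma_finite : sigma_finite setT lebesgue_cons.
Proof.
have /sigma_finiteP[F [FT ndF Foo]] := sigma_finiteT (@lebesgue_measure R).
have /sigma_finiteP[G [GT ndG Goo]] := sigma_finiteT m.
pose g (t : n.+1.-tuple R) : R * n.-tuple R := (thead t, [tuple of behead t]).
have mg : measurable_fun setT g.
  apply/measurable_fun_pairP; split => /=; last exact: measurable_behead.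
  exact: (@measurable_tnth _ _ n.+1 ord0).
have gK : cancel tuple_cons g.
  by move=> [a t]; rewrite /g /=; congr pair; apply: val_inj.
exists (fun k => g @^-1` (F k `*` G k)).
  rewrite -preimage_bigcup (_ : \bigcup_k _ = setT) ?preimage_setT//.
  rewrite -subTset => -[a t] _.
  have [i _ Fia] : (\bigcup_k F k) a by rewrite -FT.
  have [j _ Gjt] : (\bigcup_k G k) t by rewrite -GT.
  exists (maxn i j) => //; split => /=.
  - by move: a Fia; exact/subsetPset/ndF/leq_maxl.
  - by move: t Gjt; exact/subsetPset/ndG/leq_maxr.
move=> k; have [mF Fkoo] := Foo k; have [mG Gkoo] := Goo k; split.
  by rewrite -[X in measurable X]setTI; apply: mg => //; exact: measurableX.
rewrite /lebesgue_cons /pushforward -comp_preimage.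
rewrite (_ : g \o tuple_cons = id); last by apply/funext => p /=; rewrite gK.
by rewrite preimage_id product_measure1E// lte_mul_pinfty// ge0_fin_numE.
Qed.

HB.instance Definition _ := Measure_isSigmaFinite.Build _ _ _ lebesgue_cons
  lebesgue_cons_sigma_finite.

End lebesgue_tuple_step.

(* Lebesgue measure on R^n, the space R^n being [n.-tuple R] with the product
   of the Borel sigma-algebras; see [lebesgue_tuple_box]. *)
Fixpoint lebesgue_tuple (R : realType) (n : nat) :
    {sigma_finite_measure set (n.-tuple R) -> \bar R} :=
  if n is n'.+1 then lebesgue_cons (lebesgue_tuple R n') else
    \d_([tuple] : 0.-tuple R).

Lemma lebesgue_tuple_box (R : realType) (n : nat) (A : 'I_n -> set R) :
  (forall i, measurable (A i)) ->
  lebesgue_tuple R n [set t | forall i, A i (tnth t i)] =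
  (\prod_(i < n) lebesgue_measure (A i))%E.
Proof.
elim: n A => [|n IH] A mA.
  rewrite big_ord0 /= diracE mem_set//.
  by case.
rewrite big_ord_recl -IH//= /lebesgue_cons /pushforward.
rewrite -product_measure1E//; last 2 first.
- exact: mA.
- rewrite (_ : [set t | _] =
      \bigcap_(i in [set: 'I_n]) ((fun t => tnth t i) @^-1` A (lift ord0 i))).
    apply: fin_bigcap_measurable => [|i _]; first exact: finite_finset.
    by rewrite -[X in measurable X]setTI; exact: measurable_tnth.
  by apply/seteqP; split => [t /= h i _|t /= h i]; exact: h.
congr (product_measure1 _ _ _).
apply/seteqP; split => [[a t] /= h|[a t] /= [ha ht] i].
  split; first by have := h ord0; rewrite tnth0.
  by move=> i; have := h (lift ord0 i); rewrite tnthS.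
by have [j ->|->] := unliftP ord0 i; rewrite ?tnthS ?tnth0.
Qed.

(* [lne] is [-oo] at 0, but the derivative vanishes only on a [p]-null set; the
   negative part of the integrand is always [p]-integrable. *)
Definition KL d (T : measurableType d) (R : realType) (p pi : probability T R)
    : \bar R :=
  if `[< p `<< pi >] then
    (\int[p]_t lne (Radon_Nikodym (charge_of_finite_measure p) pi t))%E
  else +oo%E.

Definition mutually_independent d (T : measurableType d) (R : realType)
    (P : probability T R) (n : nat) (xi : 'I_n -> {RV P >-> R}) : Prop :=
  forall (J : {set 'I_n}) (B : 'I_n -> set R), (forall i, measurable (B i)) ->
  P (\bigcap_(i in [set i | i \in J]) (xi i @^-1` B i)) =
  (\prod_(i in J) P (xi i @^-1` B i))%E.

Definition identically_distributed d (T : measurableType d) (R : realType)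
    (P : probability T R) (n : nat) (xi : 'I_n -> {RV P >-> R}) : Prop :=
  forall i j (B : set R), measurable B ->
  distribution P (xi i) B = distribution P (xi j) B.

Definition zero_mean d (T : measurableType d) (R : realType)
    (P : probability T R) (Z : {RV P >-> R}) : Prop :=
  P.-integrable setT (EFin \o Z) /\ ('E_P[Z] = 0)%E.

Section regression.
Context {R : realType} {X : Type}.

Definition sqnorm_n (n : nat) (x : n.-tuple X) (g : X -> R) : R :=
  n%:R^-1 * \sum_(i < n) g (tnth x i) ^+ 2.

Definition response (Omega : Type) (n : nat) (x : n.-tuple X) (f : X -> R)
    (xi : 'I_n -> Omega -> R) (w : Omega) : n.-tuple R :=
  [tuple f (tnth x i) + xi i w | i < n].

(* A random function on [X] computed from the data: the design points, the
   responses, then the point at which the estimated function is evaluated. *)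
Definition is_estimator (n : nat) (x : n.-tuple X)
    (fhat : n.-tuple X -> n.-tuple R -> X -> R) : Prop :=
  forall z, measurable_fun [set: n.-tuple R] (fun y => fhat x y z).

Definition risk d (Omega : measurableType d) (P : probability Omega R)
    (n : nat) (x : n.-tuple X) (f : X -> R) (xi : 'I_n -> {RV P >-> R})
    (fhat : n.-tuple X -> n.-tuple R -> X -> R) : \bar R :=
  'E_P[fun w =>
    sqnorm_n x (fun z => fhat x (response x f (fun i => xi i) w) z - f z)].

Definition lincomb (M : nat) (phi : 'I_M -> X -> R) (l : M.-tuple R) : X -> R :=
  fun z => \sum_(j < M) tnth l j * phi j z.

End regression.

Section sparsity_prior.
Context {R : realType} {M : nat}.
Variables (tau : R) (L0 : \bar R).

Definition enorm (l : M.-tuple R) : R :=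
  Num.sqrt (\sum_(j < M) tnth l j ^+ 2).

Definition enorm_ball : set (M.-tuple R) := [set l | ((enorm l)%:E <= L0)%E].

Definition q0 (t : R) : R := 3 / (2 * (1 + `|t|) ^+ 4).

Definition unnormalized_q (l : M.-tuple R) : R :=
  (\prod_(j < M) (tau^-1 * q0 (tnth l j / tau))) * \1_enorm_ball l.

(* When [L0 = +oo] the indicator is 1 and the integral is 1, since [q0] is a
   probability density; no separate case is needed. *)
Definition C0 : R :=
  fine (\int[lebesgue_tuple R M]_l (unnormalized_q l)%:E)%E.

Definition q (l : M.-tuple R) : R := C0^-1 * unnormalized_q l.

End sparsity_prior.

(* [L0] ranges over ]0, +oo]; the value at [-oo] is irrelevant. *)
Definition remainder (R : realType) (X : Type) (n M : nat) (x : n.-tuple X)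
    (phi : 'I_M -> X -> R) (beta tau : R) (L0 : \bar R) (delta : R) : R :=
  let S := \sum_(j < M) sqnorm_n x (phi j) in
  match L0 with
  | r%:E =>
      tau ^+ 2
        * expR (2 * tau ^+ 3 * M%:R `^ (5 / 2) * ((delta * r) ^+ 3)^-1) * S
      + 2 * beta * tau ^+ 3 * M%:R `^ (5 / 2) / (n%:R * delta ^+ 3 * r ^+ 3)
  | _ => tau ^+ 2 * S
  end.

(* Main.v *)
From HB Require Import structures.
Require Import Defs.
From mathcomp Require Import all_boot all_order all_algebra.
From mathcomp Require Import all_classical all_reals all_analysis.
From mathcomp Require Import measurable_realfun ring lra.

(* Apply the risk bound to the prior without its indicator, translated to
   lambda* and conditioned on the box |lambda_j - lambda*_j| <= delta L0 / sqrt M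
   (on all of R^M when L0 is infinite).  The box lies inside the ball of radius
   delta L0, so this p is carried by the ball of radius L0, and unlike the
   conditioning on a ball it keeps p a product measure, symmetric about lambda*:
   the quadratic risk splits as ||f_lambda* - f||^2 plus variances, each at most
   tau^2 / c, where c is the mass of one edge.  Since
   1 + |t| <= (1 + |m|) (1 + |t - m|), the density of p is at most
   K = prod_j (1 + |lambda*_j| / tau)^4 / c times that of the prior, so that
   KL(p, pi) <= ln K.  Finally c = 1 - (tau / (tau + S))^3 with
   S = delta L0 / sqrt M >= tau, and - ln (1 - y) <= 2 y for y <= 1/2. *)

Local Open Scope classical_set_scope.
Local Open Scope ring_scope.

(** * Probability measures given by densities, and a bound on the divergence *)

Lemma density_probability (d : measure_display) (T : measurableType d)
    (R : realType) (mu : {measure set T -> \bar R}) (h : T -> R) :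
  (forall x, 0 <= h x) -> measurable_fun setT h ->
  (\int[mu]_x (h x)%:E = 1)%E ->
  exists p : probability T R, forall A, measurable A ->
    p A = (\int[mu]_(x in A) (h x)%:E)%E.
Proof.
move=> h0 mh h1.
pose nu (A : set T) : \bar R := (\int[mu]_(x in A) (h x)%:E)%E.
have nu0 : nu set0 = 0%E by rewrite /nu integral_set0.
have nu_ge0 A : (0 <= nu A)%E by apply: integral_ge0 => x _; rewrite lee_fin.
have nuS : semi_sigma_additive nu.
  move=> A mA tA mUA; rewrite /nu ge0_integral_bigcup//=.
  - by apply: is_cvg_ereal_nneg_natsum_cond => n _ _; exact: nu_ge0.
  - exact/measurable_EFinP/measurable_funTS.
  - by move=> x _; rewrite lee_fin.
pose m := isMeasure.Build _ _ _ nu nu0 nu_ge0 nuS.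
pose nuM : {measure set T -> \bar R} := HB.pack nu m.
have nu1 : nuM setT = 1%E by [].
pose mp := Measure_isProbability.Build _ _ _ nuM nu1.
pose p : probability T R := HB.pack nu m mp.
by exists p.
Qed.

(** Here [p] is known only through its values on sets. They force its Radon-Nikodym derivative to
    agree with [h] almost everywhere, and the change of variables applies to that derivative. *)
Lemma ge0_integral_density (d : measure_display) (T : measurableType d)
    (R : realType) (mu : {sigma_finite_measure set T -> \bar R})
    (p : probability T R) (h : T -> R) (F : T -> R) :
  (forall x, 0 <= h x) -> measurable_fun setT h ->
  (forall A, measurable A -> p A = (\int[mu]_(x in A) (h x)%:E)%E) ->
  (forall x, 0 <= F x) -> measurable_fun setT F ->
  (\int[p]_x (F x)%:E = \int[mu]_x (F x * h x)%:E)%E.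
Proof.
move=> h0 mh ph F0 mF.
have pmu : p `<< mu.
  apply/null_content_dominatesP => A mA muA0.
  rewrite ph// null_set_integral//.
  exact/measurable_EFinP/measurable_funTS.
pose g := Radon_Nikodym_SigmaFinite.f p mu.
have ig := Radon_Nikodym_SigmaFinite.f_integrable pmu.
have gh : ae_eq mu setT g (EFin \o h).
  apply: integral_ae_eq => //.
  - exact/measurable_EFinP.
  - by move=> A _ mA; rewrite -ph// -Radon_Nikodym_SigmaFinite.f_integral.
rewrite -(Radon_Nikodym_SigmaFinite.change_of_variables pmu)//; last first.
  exact/measurable_EFinP.
under [RHS]eq_integral do rewrite EFinM.
apply: ae_eq_integral => //.
- apply: emeasurable_funM; first exact/measurable_EFinP.
  exact: measurable_int ig.
- by apply: emeasurable_funM; exact/measurable_EFinP.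
- exact: ae_eqe_mul2l gh.
Qed.

(** On the set [A] where the derivative [g] exceeds [K], the integral of [g - K] is
    [p A - K * pi A <= 0]; so [A] is null for [pi], hence for [p], and off [A] the logarithm of [g]
    is at most [ln K]. *)
Lemma KL_le_ln (d : measure_display) (T : measurableType d) (R : realType)
    (p pi : probability T R) (K : R) : 1 <= K ->
  (forall A, measurable A -> (p A <= K%:E * pi A)%E) ->
  (KL p pi <= (ln K)%:E)%E.
Proof.
move=> K1 pK.
have K0 : 0 < K by exact: lt_le_trans K1.
have ppi : p `<< pi.
  apply/null_content_dominatesP => A mA piA0.
  by apply/eqP; rewrite eq_le measure_ge0 andbT (le_trans (pK _ mA))// piA0 mule0.
rewrite /KL; case: asboolP => // _.
set g := Radon_Nikodym _ _.
have ig : pi.-integrable setT g by exact: Radon_Nikodym_integrable.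
have mg : measurable_fun setT g by exact: measurable_int ig.
have gfin t : g t \is a fin_num by exact: Radon_Nikodym_fin_num.
pose A := [set t | (K%:E < g t)%E].
have mA : measurable A.
  rewrite -[A]setTI; exact: (emeasurable_fun_o_infty measurableT mg).
have piA : pi A = 0%E.
  have mgK : measurable_fun A (fun t => g t - K%:E)%E.
    by apply: emeasurable_funB => //; exact: measurable_funTS.
  have gK0 t : A t -> (0 < g t - K%:E)%E by rewrite sube_gt0.
  have int0 : (\int[pi]_(t in A) `|g t - K%:E| = 0)%E.
    apply/eqP; rewrite eq_le integral_ge0// andbT.
    under eq_integral => t /[!inE] At do rewrite gee0_abs ?(ltW (gK0 _ At))//.
    rewrite integralB//; last 2 first.
    - exact: integrableS ig.
    - exact: finite_measure_integrable_cst.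
    by rewrite integral_cst// -Radon_Nikodym_integral//= sube_le0 pK.
  have [N [mN piN0 subN]] : ae_eq pi A (fun t => g t - K%:E)%E (cst 0%E).
    by apply/ae_eq_integral_abs.
  apply/eqP; rewrite eq_le measure_ge0 andbT -piN0 le_measure ?inE// => t At.
  by apply: subN => /= /(_ At); have := gK0 _ At => /[swap] ->; rewrite ltxx.
have pA : p A = 0%E.
  by apply/eqP; rewrite eq_le measure_ge0 andbT (le_trans (pK _ mA))// piA mule0.
have lnK0 : (0 <= (ln K)%:E)%E by rewrite lee_fin ln_ge0.
have mlneg : measurable_fun setT (@lne R \o g).
  have -> : @lne R \o g =
      (fun t => if (g t <= 0)%E then -oo%E else (ln (fine (g t)))%:E).
    by apply/funext => t /=; have := gfin t; case: (g t).
  apply: measurable_fun_ifT => //.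
    exact: measurable_fun_lee.
  by apply/measurable_EFinP; apply: measurableT_comp => //; exact: measurableT_comp.
(* Only the positive part has to be bounded, and [ln K] dominates it off [A] because [1 <= K] makes
   [ln K] nonnegative. *)
rewrite integralE; apply: (@le_trans _ _ (\int[p]_t (@lne R \o g)^\+ t)%E).
  by rewrite geeDl// oppe_le0 integral_ge0.
apply: (@le_trans _ _ (\int[p]_t (ln K)%:E)%E); last first.
  by rewrite integral_cst// [X in (_ * X)%E]probability_setT mule1.
apply: ae_ge0_le_integral => //.
- exact: measurable_funepos.
- exists A; split => // t /= Nt; rewrite /A /= ltNge; apply/negP => gtK.
  apply: Nt => _; rewrite funeposE ge_max lnK0 andbT /=.
  have := gfin t; case: (g t) gtK => //= r.
  rewrite lee_fin => rK _; case: ifPn => r0; first by rewrite leNye.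
  by rewrite lee_fin ler_ln ?posrE// ltNge.
Qed.

(** * Integration over [n.-tuple R] against product densities *)

Lemma measurable_prod_tnth (R : realType) (n : nat) (a : 'I_n -> R -> R) :
  (forall j, measurable_fun setT (a j)) ->
  measurable_fun setT (fun l : n.-tuple R => \prod_(j < n) a j (tnth l j)).
Proof.
move=> ma; apply: measurable_prod => j _.
by apply: measurableT_comp => //; exact: measurable_tnth.
Qed.

Lemma measurable_sqr_affine (R : realType) (n : nat) (r : R) (b : 'I_n -> R) :
  measurable_fun setT
    (fun l : n.-tuple R => (r + \sum_(j < n) tnth l j * b j) ^+ 2).
Proof.
apply/measurable_funX/measurable_funD => //.
apply: measurable_sum => j; apply: measurable_funM => //.
exact: measurable_tnth.
Qed.

(** Tonelli with the first coordinate split off; it drives both inductions on the dimension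
    below. *)
Lemma ge0_integral_lebesgue_tupleS (R : realType) (n : nat)
    (F : n.+1.-tuple R -> \bar R) :
  (forall l, 0 <= F l)%E -> measurable_fun setT F ->
  (\int[lebesgue_tuple R n.+1]_l F l =
   \int[lebesgue_measure]_a \int[lebesgue_tuple R n]_t F (tuple_cons (a, t)))%E.
Proof.
move=> F0 mF.
transitivity (\int[lebesgue_measure \x lebesgue_tuple R n]_z
    (F \o tuple_cons) z)%E.
  rewrite -[X in _ = (\int[_]_(x in X) _)%E](preimage_setT tuple_cons).
  by rewrite -ge0_integral_pushforward//; exact: measurable_tuple_cons.
rewrite fubini_tonelli1//.
  by apply: measurableT_comp => //; exact: measurable_tuple_cons.
by move=> z; exact: F0.
Qed.

Lemma integral_prod_lebesgue_tuple (R : realType) (n : nat)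
    (a : 'I_n -> R -> R) :
  (forall j t, 0 <= a j t) -> (forall j, measurable_fun setT (a j)) ->
  (\int[lebesgue_tuple R n]_l (\prod_(j < n) a j (tnth l j))%:E =
   \prod_(j < n) \int[lebesgue_measure]_t (a j t)%:E)%E.
Proof.
elim: n a => [|n IH] a a0 ma.
  under eq_integral do rewrite big_ord0.
  by rewrite big_ord0 integral_cst//= diracT mule1.
rewrite ge0_integral_lebesgue_tupleS; last 2 first.
- by move=> l; rewrite lee_fin prodr_ge0.
- by apply/measurable_EFinP; exact: (@measurable_prod_tnth _ _ a).
rewrite big_ord_recl -(IH (fun j => a (lift ord0 j)))//.
transitivity (\int[lebesgue_measure]_t ((a ord0 t)%:E *
    \int[lebesgue_tuple R n]_l (\prod_(j < n) a (lift ord0 j) (tnth l j))%:E))%E.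
  apply: eq_integral => t _.
  rewrite -ge0_integralZl//; last 3 first.
  - apply/measurable_EFinP.
    exact: (@measurable_prod_tnth _ _ (fun j => a (lift ord0 j))).
  - by move=> l _; rewrite lee_fin prodr_ge0.
  - by rewrite lee_fin.
  apply: eq_integral => l _; rewrite big_ord_recl tnth0 -EFinM.
  by under eq_bigr do rewrite tnthS.
rewrite ge0_integralZr//.
- by apply/measurable_EFinP; exact: ma.
- by move=> t _; rewrite lee_fin.
- by apply: integral_ge0 => l _; rewrite lee_fin prodr_ge0.
Qed.

(** The one-dimensional hypothesis, quantified over [r] and [b], encodes mass 1, mean [m j] and
    variance [v j] at once. The induction integrates the tail with [r] replaced by [r + t * b ord0],
    which leaves a one-dimensional integral of the same shape plus a constant multiple of the
    mass. *)
Lemma integral_sqr_affine_prod (R : realType) (n : nat) (a : 'I_n -> R -> R)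
    (m v : 'I_n -> R) :
  (forall j t, 0 <= a j t) -> (forall j, measurable_fun setT (a j)) ->
  (forall j r b, \int[lebesgue_measure]_t ((r + t * b) ^+ 2 * a j t)%:E =
    ((r + m j * b) ^+ 2 + b ^+ 2 * v j)%:E)%E ->
  forall (r : R) (b : 'I_n -> R),
  (\int[lebesgue_tuple R n]_l
     ((r + \sum_(j < n) tnth l j * b j) ^+ 2 *
      \prod_(j < n) a j (tnth l j))%:E =
   ((r + \sum_(j < n) m j * b j) ^+ 2 + \sum_(j < n) b j ^+ 2 * v j)%:E)%E.
Proof.
elim: n a m v => [|n IH] a m v a0 ma amv r b.
  under eq_integral do rewrite !big_ord0.
  by rewrite !big_ord0 integral_cst//= diracT mule1 mulr1 !addr0.
have mg (t : R) : measurable_fun setT (fun l : n.-tuple R =>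
    ((r + t * b ord0 + \sum_(j < n) tnth l j * b (lift ord0 j)) ^+ 2 *
     \prod_(j < n) a (lift ord0 j) (tnth l j))%:E).
  apply/measurable_EFinP; apply: measurable_funM.
  exact: measurable_sqr_affine.
  exact: (@measurable_prod_tnth _ _ (fun j => a (lift ord0 j))).
(* Taking [r = 1] and [b = 0] isolates the total mass. *)
have a1 : (\int[lebesgue_measure]_t (a ord0 t)%:E = 1)%E.
  have := amv ord0 1 0.
  under eq_integral do rewrite mulr0 addr0 expr1n mul1r.
  by move=> ->; rewrite mulr0 addr0 expr0n mul0r expr1n addr0.
rewrite ge0_integral_lebesgue_tupleS; last 2 first.
- by move=> l; rewrite lee_fin mulr_ge0 ?sqr_ge0 ?prodr_ge0.
- apply/measurable_EFinP; apply: measurable_funM; first exact: measurable_sqr_affine.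
  exact: (@measurable_prod_tnth _ _ a).
(* Taking [r = - m] and [b = 1] exhibits [v] as the integral of a nonnegative function; the sign is
   needed to split the integral below. *)
have v0 : 0 <= \sum_(j < n) b (lift ord0 j) ^+ 2 * v (lift ord0 j).
  apply: sumr_ge0 => j _; rewrite mulr_ge0 ?sqr_ge0//.
  have := amv (lift ord0 j) (- m (lift ord0 j)) 1.
  rewrite mulr1 addNr expr0n add0r expr1n mul1r => /esym vE.
  by rewrite -lee_fin vE integral_ge0// => t _; rewrite lee_fin mulr_ge0 ?sqr_ge0.
pose V := \sum_(j < n) b (lift ord0 j) ^+ 2 * v (lift ord0 j).
pose r' := r + \sum_(j < n) m (lift ord0 j) * b (lift ord0 j).
transitivity (\int[lebesgue_measure]_t
    (((r' + t * b ord0) ^+ 2 * a ord0 t)%:E + (V * a ord0 t)%:E))%E.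
  apply: eq_integral => t _.
  transitivity ((a ord0 t)%:E * \int[lebesgue_tuple R n]_l
    ((r + t * b ord0 + \sum_(j < n) tnth l j * b (lift ord0 j)) ^+ 2 *
     \prod_(j < n) a (lift ord0 j) (tnth l j))%:E)%E.
    rewrite -ge0_integralZl//; last 2 first.
    - by move=> l _; rewrite lee_fin mulr_ge0 ?sqr_ge0 ?prodr_ge0.
    - by rewrite lee_fin.
    apply: eq_integral => l _; rewrite !big_ord_recl tnth0 -EFinM mulrCA addrA.
    congr (_ * ((_ + _) ^+ 2 * _))%:E;
      by apply: eq_bigr => j _; rewrite tnthS.
  rewrite (IH (fun j => a (lift ord0 j)) (fun j => m (lift ord0 j))
    (fun j => v (lift ord0 j)))// -EFinM -EFinD; congr EFin.
  by rewrite /r' /V; ring.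
rewrite ge0_integralD//; last 4 first.
- by move=> t _; rewrite lee_fin mulr_ge0 ?sqr_ge0.
- apply/measurable_EFinP/measurable_funM; last exact: ma.
  apply: measurable_funX.
  by apply: measurable_funD => //; exact: measurable_funM.
- by move=> t _; rewrite lee_fin mulr_ge0.
- by apply/measurable_EFinP; apply: measurable_funM => //; exact: ma.
rewrite amv.
under eq_integral do rewrite EFinM.
rewrite ge0_integralZl//; last 2 first.
- by apply/measurable_EFinP; exact: ma.
- by move=> t _; rewrite lee_fin.
rewrite a1 mule1 -EFinD /r' /V !big_ord_recl; congr EFin; ring.
Qed.

(** * Translation and reflection of Lebesgue measure on the line *)

Section lebesgue_line.
Context {R : realType}.
Local Notation mu := (@lebesgue_measure R).

(** Uniqueness of Lebesgue measure reduces invariance to half-open intervals, whose length a shift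
    preserves. *)
Lemma lebesgue_measureD (m : R) (A : set R) : measurable A ->
  pushforward mu (+%R m : _ -> measurableTypeR R) A = mu A.
Proof.
move=> mA; apply/esym/lebesgue_measure_unique => //=.
  exact: measurable_funD.
move=> _ _ [[a b]] _ <-.
rewrite /pushforward (_ : _ @^-1` _ = `]a - m, b - m]%classic).
  by rewrite !lebesgue_measure_itv/= !lte_fin ltrD2r -!EFinB opprD
    opprK addrACA addNr addr0.
by apply/seteqP; split => x /=; rewrite !in_itv/= lerBrDl ltrBlDl.
Qed.

Lemma ge0_integral_shift (m : R) (f : R -> \bar R) :
  measurable_fun setT f -> (forall t, 0 <= f t)%E ->
  (\int[mu]_t f t = \int[mu]_t f (m + t)%R)%E.
Proof.
move=> mf f0.
have mD : measurable_fun setT (+%R m : R -> measurableTypeR R).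
  exact: measurable_funD.
transitivity (\int[pushforward mu (+%R m : R -> measurableTypeR R)]_t f t)%E.
  by apply: eq_measure_integral => //= A mA _; exact/esym/lebesgue_measureD.
by rewrite ge0_integral_pushforward.
Qed.

(** This moves integrals to the half line, where the absolute value in the kernel disappears and the
    integrand becomes a rational function. *)
Lemma ge0_integral_fold (m : R) (f : R -> R) :
  measurable_fun setT f -> (forall t, 0 <= f t) ->
  (\int[mu]_t (f t)%:E =
   \int[mu]_(u in `[0%R, +oo[) (f (m + u) + f (m - u))%:E)%E.
Proof.
move=> mf f0.
have mg : measurable_fun setT (fun u : R => f (m + u)).
  by apply: measurableT_comp => //; exact: measurable_funD.
have mgN : measurable_fun setT (fun u : R => f (m - u)).
  by apply: measurableT_comp => //; exact: measurable_funB.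
rewrite (@ge0_integral_shift m (EFin \o f))//; last exact/measurable_EFinP.
under [RHS]eq_integral do rewrite EFinD.
rewrite ge0_integralD//; last 4 first.
- by move=> t _; rewrite lee_fin.
- exact/measurable_EFinP/measurable_funTS.
- by move=> t _; rewrite lee_fin.
- exact/measurable_EFinP/measurable_funTS.
rewrite -(setUv `[0%R, +oo[%classic) ge0_integral_setU//=; last 4 first.
- exact: measurableC.
- by rewrite setUv; exact/measurable_EFinP.
- by move=> t _; rewrite lee_fin.
- exact/disj_setPCl.
congr (_ + _)%E.
(* The complement of the closed half line omits 0; adding this null endpoint gives the reflected
   closed half line. *)
rewrite setCitvr integral_itv_bndo_bndc; last exact/measurable_EFinP/measurable_funTS.
rewrite ge0_integration_by_substitution0//.
- by apply: eq_integral => u _; rewrite opprK.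
- exact/measurable_EFinP.
- by move=> r; rewrite lee_fin.
Qed.

End lebesgue_line.

(** * Closed-form integrals of the one-dimensional prior kernel *)

Section sparsity_kernel.
Context {R : realType}.
Variable tau : R.
Hypothesis tau_gt0 : 0 < tau.
Local Notation mu := (@lebesgue_measure R).

Definition kernel_tau (t : R) : R := tau^-1 * q0 (t / tau).

(** For [u >= 0] the kernel is [3 / (2 * tau) * w u ^+ 4], so the folded integrands are polynomials
    in [w] and [u]. Ring operations on functions, rather than pointwise formulas, let derivatives be
    inferred from the shape. *)
Let w : R -> R := cst tau * (fun u => (tau + u)^-1).

Let f (A b : R) : R -> R :=
  (3 / tau) *: (w ^+ 4 * (cst (A ^+ 2) + b ^+ 2 *: (id ^+ 2))).

(* A primitive of [f A b], found as a polynomial in [w] using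
   [w' = - w ^+ 2 / tau] and [u = tau * (1 - w) / w]. *)
Let W (A b : R) : R -> R :=
  A ^+ 2 *: (cst 1 - w ^+ 3) + (b ^+ 2 * tau ^+ 2) *: (cst 1 - w) ^+ 3.

Let is_derive_w (u : R) : 0 <= u -> is_derive u 1 w (- (w u ^+ 2 / tau)).
Proof.
move=> u0.
have tu : tau + u != 0 by rewrite gt_eqF// ltr_pwDl.
have dD : is_derive u 1 (fun y : R => tau + y) 1.
  by have := @is_deriveD _ _ _ (cst tau) id u 1 0 1 _ _; rewrite add0r; apply.
have dV : is_derive u 1 (fun y => (tau + y)^-1) (- (tau + u) ^- 2).
  apply: DeriveDef; first exact: derivableV.
  by rewrite deriveV// derive_val scaler1.
rewrite /w; apply: is_derive_eq.
rewrite /= scaler0 addr0 !fctE /cst /GRing.scale/=.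
by field; rewrite tu gt_eqF.
Qed.

Let is_derive_W (A b u : R) : 0 <= u -> is_derive u 1 (W A b) (f A b u).
Proof.
move=> u0; have dw := is_derive_w _ u0.
have tu : tau + u != 0 by rewrite gt_eqF// ltr_pwDl.
rewrite /W; apply: is_derive_eq.
rewrite /f /w !fctE /cst /GRing.scale/=.
by field; rewrite tu gt_eqF.
Qed.

Let derivable_f (A b u : R) : 0 <= u -> derivable (f A b) u 1.
Proof.
move=> u0; have dw := is_derive_w _ u0; rewrite /f.
exact: ex_derive.
Qed.

Let fE (A b u : R) : 0 <= u ->
  ((A + u * b) ^+ 2 + (A - u * b) ^+ 2) * kernel_tau u = f A b u.
Proof.
move=> u0; rewrite /kernel_tau /q0 ger0_norm ?divr_ge0 ?(ltW tau_gt0)//.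
rewrite /f /w !fctE /cst /GRing.scale/=.
have tu : tau + u != 0 by rewrite gt_eqF// ltr_pwDl.
field; rewrite tu gt_eqF//=.
Qed.

Let continuous_W (A b u : R) : 0 <= u -> {for u, continuous (W A b)}.
Proof.
move=> u0; apply/differentiable_continuous/derivable1_diffP.
by have dW := is_derive_W A b _ u0; exact: ex_derive.
Qed.

Let W0 (A b : R) : W A b 0 = 0.
Proof.
rewrite /W /w !fctE /cst /GRing.scale/=.
by field; rewrite gt_eqF.
Qed.

(* The sum of the two squares is [(A + t * b) ^+ 2] folded along [t |-> - t], so
   that [A = 1, b = 0] gives the mass and [A = 0, b = 1] the second moment. *)
Lemma integral_kernel_tau_itv (S A b : R) : 0 < S ->
  (\int[mu]_(u in `[0%R, S])
     (((A + u * b) ^+ 2 + (A - u * b) ^+ 2) * kernel_tau u)%:E =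
   ((1 - (tau / (tau + S)) ^+ 3) * A ^+ 2
    + b ^+ 2 * (tau ^+ 2 * (S / (tau + S)) ^+ 3))%:E)%E.
Proof.
move=> S0.
transitivity (\int[mu]_(u in `[0%R, S]) (f A b u)%:E)%E.
  by apply: eq_integral => u; rewrite inE/= in_itv/= => /andP[u0 _]; rewrite fE.
rewrite (@continuous_FTC2 _ _ (W A b))//.
- rewrite W0 sube0 /W /w !fctE /cst /GRing.scale/=; congr EFin.
  by field; rewrite gt_eqF// addr_gt0.
- apply: derivable_within_continuous => u; rewrite in_itv/= => /andP[u0 _].
  exact: derivable_f.
- split.
  + move=> u; rewrite in_itv/= => /andP[/ltW u0 _].
    by have dW := is_derive_W A b _ u0; exact: ex_derive.
  + exact/cvg_at_right_filter/continuous_W.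
  + exact/cvg_at_left_filter/continuous_W/ltW.
- move=> u; rewrite in_itv/= => /andP[/ltW u0 _].
  by rewrite derive1E; have dW := is_derive_W A b _ u0; rewrite derive_val.
Qed.

Let cvg_w : w u @[u --> +oo] --> 0.
Proof.
rewrite -[X in _ --> X](mulr0 tau); apply: cvgM; first exact: cvg_cst.
apply/gtr0_cvgV0; last exact: cvg_addrl.
by near=> u; rewrite addr_gt0//; near: u; exact: nbhs_pinfty_gt.
Unshelve. all: by end_near. Qed.

(** As [u] grows, [w u] tends to 0 and the primitive [W] has a finite limit. So the untruncated
    kernel has mass 1 ([A = 1], [b = 0]) and second moment [tau ^+ 2] ([A = 0], [b = 1]). *)
Lemma integral_kernel_tau_pinfty (A b : R) :
  (\int[mu]_(u in `[0%R, +oo[)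
     (((A + u * b) ^+ 2 + (A - u * b) ^+ 2) * kernel_tau u)%:E =
   (A ^+ 2 + b ^+ 2 * tau ^+ 2)%:E)%E.
Proof.
transitivity (\int[mu]_(u in `[0%R, +oo[) (f A b u)%:E)%E.
  by apply: eq_integral => u; rewrite inE/= in_itv/= andbT => u0; rewrite fE.
have -> : (A ^+ 2 + b ^+ 2 * tau ^+ 2)%:E =
    ((A ^+ 2 + b ^+ 2 * tau ^+ 2)%:E - (W A b 0)%:E)%E by rewrite W0 sube0.
apply: ge0_continuous_FTC2y.
- move=> u u0; rewrite -fE// mulr_ge0 ?addr_ge0 ?sqr_ge0//.
  by rewrite mulr_ge0 ?invr_ge0 ?ltW// divr_gt0// mulr_gt0// exprn_gt0// ltr_pwDl.
- apply: derivable_within_continuous => u; rewrite in_itv/= andbT => u0.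
  exact: derivable_f.
- have cvg3 (g : R -> R) (l : R) :
      g u @[u --> +oo] --> l -> (g ^+ 3) u @[u --> +oo] --> l ^+ 3.
    by move=> gl; rewrite !exprS !expr0 !mulr1; do 2 apply: cvgM => //.
  (* The limit is written as [W] with [w] replaced by 0, so that it can be matched term by term. *)
  have -> : A ^+ 2 + b ^+ 2 * tau ^+ 2 =
      A ^+ 2 *: (1 - 0 ^+ 3) + (b ^+ 2 * tau ^+ 2) *: (1 - 0) ^+ 3 :> R.
    by rewrite /GRing.scale/=; ring.
  apply: cvgD; apply: cvgZr.
    by apply: cvgB; [exact: cvg_cst|exact: cvg3].
  by apply: cvg3; apply: cvgB; [exact: cvg_cst|].
- by move=> u /ltW u0; have dW := is_derive_W A b _ u0; exact: ex_derive.
- exact/cvg_at_right_filter/continuous_W.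
- move=> u; rewrite in_itv/= andbT => /ltW u0.
  by rewrite derive1E; have dW := is_derive_W A b _ u0; rewrite derive_val.
Qed.

End sparsity_kernel.

(** * The kernel moved to a new centre, truncated and renormalised *)

Section shifted_kernel.
Context {R : realType}.
Variable tau : R.
Hypothesis tau_gt0 : 0 < tau.
Local Notation mu := (@lebesgue_measure R).

Lemma kernel_tau_ge0 (t : R) : 0 <= kernel_tau tau t.
Proof.
rewrite mulr_ge0 ?invr_ge0 ?(ltW tau_gt0)//.
by rewrite divr_ge0// mulr_ge0// exprn_ge0// addr_ge0.
Qed.

Lemma measurable_kernel_tau : measurable_fun setT (kernel_tau tau).
Proof.
apply: continuous_measurable_fun => t.
apply: cvgM; first exact: cvg_cst.
apply: cvgM; first exact: cvg_cst.
apply: cvgV; first by rewrite gt_eqF// mulr_gt0// exprn_gt0// ltr_pwDl.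
apply: cvgM; first exact: cvg_cst.
apply: (@continuous_comp _ _ _ (fun x : R => 1 + `|x / tau|) (fun y => y ^+ 4)).
  apply: cvgD; first exact: cvg_cst.
  by apply: cvg_norm; apply: cvgM => //; exact: cvg_cst.
exact: exprn_continuous.
Qed.

Lemma kernel_tauN (t : R) : kernel_tau tau (- t) = kernel_tau tau t.
Proof. by rewrite /kernel_tau /q0 mulNr normrN. Qed.

Lemma integral_kernel_tau : (\int[mu]_t (kernel_tau tau t)%:E = 1)%E.
Proof.
rewrite (ge0_integral_fold 0); [|exact: measurable_kernel_tau|exact: kernel_tau_ge0].
have := integral_kernel_tau_pinfty _ tau_gt0 1 0.
rewrite expr1n expr0n mul0r addr0 => <-.
apply: eq_integral => u _; rewrite add0r sub0r kernel_tauN mulr0 addr0 subr0.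
by rewrite expr1n mulrDl mul1r.
Qed.

(** Polynomial tails make a change of centre cost only a power of [1 + |m| / tau], hence a logarithm
    in the divergence. The exponent 4 of [q0] becomes the factor 4 of the final bound. *)
Lemma kernel_tau_shift_le (m t : R) :
  kernel_tau tau (t - m) <= (1 + tau^-1 * `|m|) ^+ 4 * kernel_tau tau t.
Proof.
have posD (x y : R) : 0 < y -> 0 < 1 + y^-1 * `|x|.
  by move=> y0; rewrite ltr_pwDl// mulr_ge0// invr_ge0 ltW.
have nE x : `|x / tau| = tau^-1 * `|x|.
  by rewrite normrM normfV (gtr0_norm tau_gt0) mulrC.
rewrite /kernel_tau /q0 !nE.
have := posD (t - m) _ tau_gt0; have := posD m _ tau_gt0; have := posD t _ tau_gt0.
have : 1 + tau^-1 * `|t| <= (1 + tau^-1 * `|m|) * (1 + tau^-1 * `|t - m|).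
  have tri : `|t| <= `|t - m| + `|m| by rewrite -{1}(subrK m t) ler_normD.
  have : tau^-1 * `|t| <= tau^-1 * (`|t - m| + `|m|).
    by rewrite ler_wpM2l// invr_ge0 ltW.
  have p1 : 0 <= tau^-1 * `|t - m| by rewrite mulr_ge0// invr_ge0 ltW.
  have p2 : 0 <= tau^-1 * `|m| by rewrite mulr_ge0// invr_ge0 ltW.
  by nra.
(* With the three factors abstracted, the claim is [z^-1 ^+ 4 <= (y / x) ^+ 4], which follows from
   [x <= y * z]. *)
move: (1 + _ * `|t|) (1 + _ * `|m|) (1 + _ * `|t - m|) => x y z xyz x0 y0 z0.
have -> : tau^-1 * (3 / (2 * z ^+ 4)) = tau^-1 * (3 / 2) * z^-1 ^+ 4.
  by field; rewrite !gt_eqF.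
have -> : y ^+ 4 * (tau^-1 * (3 / (2 * x ^+ 4))) = tau^-1 * (3 / 2) * (y / x) ^+ 4.
  by field; rewrite !gt_eqF.
rewrite ler_wpM2l ?mulr_ge0 ?invr_ge0 ?(ltW tau_gt0)//.
rewrite lerXn2r ?nnegrE ?divr_ge0 ?invr_ge0 ?(ltW x0) ?(ltW y0) ?(ltW z0)//.
by rewrite ler_pdivlMr// ler_pdivrMl// mulrC.
Qed.

(** [D] is a set of admissible distances to the centre [m], which makes the truncation symmetric by
    construction; [c] is meant to be the mass that it keeps. *)
Definition shifted_kernel (D : set R) (c m t : R) : R :=
  c^-1 * kernel_tau tau (t - m) * \1_D `|t - m|.

Lemma shifted_kernel_ge0 (D : set R) (c m t : R) : 0 <= c ->
  0 <= shifted_kernel D c m t.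
Proof.
move=> c0; apply: mulr_ge0; last by rewrite indicE ler0n.
by apply: mulr_ge0; [rewrite invr_ge0|exact: kernel_tau_ge0].
Qed.

Lemma measurable_shifted_kernel (D : set R) (c m : R) : measurable D ->
  measurable_fun setT (shifted_kernel D c m).
Proof.
move=> mD.
have mB : measurable_fun setT (fun t : R => t - m) by exact: measurable_funB.
apply: measurable_funM.
  apply: measurable_funM => //; apply: measurableT_comp mB.
  exact: measurable_kernel_tau.
apply: (measurableT_comp (measurable_indic mD)).
by apply: measurableT_comp mB; exact: normr_measurable.
Qed.

(** Folding about [m] pairs [m + u] with [m - u], where the kernel takes equal values, so the cross
    terms cancel and the mean is [m]. Dividing by the mass [c] turns the second moment [v] into the
    variance [v / c]. *)
Lemma integral_sqr_shifted_kernel (D : set R) (c v m r b : R) :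
  measurable D -> D `<=` `[0, +oo[%classic -> 0 < c ->
  (forall A B : R, (\int[mu]_(u in D)
     (((A + u * B) ^+ 2 + (A - u * B) ^+ 2) * kernel_tau tau u)%:E =
     (c * A ^+ 2 + B ^+ 2 * v)%:E)%E) ->
  (\int[mu]_t ((r + t * b) ^+ 2 * shifted_kernel D c m t)%:E =
   ((r + m * b) ^+ 2 + b ^+ 2 * (v / c))%:E)%E.
Proof.
move=> mD Dge0 c0 HD.
have msq : measurable_fun setT (fun t : R => (r + t * b) ^+ 2).
  by apply/measurable_funX/measurable_funD => //; exact: measurable_funM.
rewrite (ge0_integral_fold m); last 2 first.
- by apply: measurable_funM => //; exact: measurable_shifted_kernel.
- by move=> t; rewrite mulr_ge0 ?sqr_ge0 ?shifted_kernel_ge0 ?(ltW c0).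
pose G (u : R) := c^-1 *
  (((r + m * b + u * b) ^+ 2 + (r + m * b - u * b) ^+ 2) * kernel_tau tau u).
(* Both paired points lie at distance [u] from [m], so the indicator of [D] becomes a restriction of
   the domain. *)
transitivity (\int[mu]_(u in `[0%R, +oo[) ((EFin \o G) \_ D) u)%E.
  apply: eq_integral => u; rewrite inE/= in_itv/= andbT => u0.
  have mu_m : m + u - m = u by ring.
  have mNu_m : m - u - m = - u by ring.
  rewrite /shifted_kernel mu_m mNu_m kernel_tauN normrN ger0_norm// patchE.
  have [uD|uD] := pselect (D u); last first.
    by rewrite indicE !memNset//= !mulr0 addr0.
  rewrite indicE !mem_set//=.
  rewrite /= /G; congr EFin; ring.
rewrite -integral_mkcondr setIidr//.
under eq_integral do rewrite /= EFinM.
rewrite ge0_integralZl//; last 3 first.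
- apply/measurable_EFinP/measurable_funTS.
  apply: measurable_funM; last exact: measurable_kernel_tau.
  apply: measurable_funD; apply: measurable_funX.
    by apply: measurable_funD => //; exact: measurable_funM.
  by apply: measurable_funB => //; exact: measurable_funM.
- by move=> u _; rewrite lee_fin mulr_ge0 ?addr_ge0 ?sqr_ge0 ?kernel_tau_ge0.
- by rewrite lee_fin invr_ge0 ltW.
rewrite HD -EFinM; congr EFin; field; rewrite gt_eqF//.
Qed.

End shifted_kernel.

Lemma ln_prod (R : realType) (n : nat) (F : 'I_n -> R) :
  (forall i, 0 < F i) -> ln (\prod_(i < n) F i) = \sum_(i < n) ln (F i).
Proof.
move=> F0; suff [_ ->] : 0 < \prod_(i < n) F i /\
  ln (\prod_(i < n) F i) = \sum_(i < n) ln (F i) by [].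
elim/big_rec2: _ => [|i y1 y2 _ [y20 <-]]; first by rewrite ln1.
by rewrite mulr_gt0 ?F0//= lnM ?posrE ?F0.
Qed.

(** * The normalising constant and the density ratio *)

Section sparsity_prior_facts.
Context {R : realType} {M : nat}.
Variables (tau : R) (L0 : \bar R).
Hypothesis tau_gt0 : 0 < tau.
Local Notation leb := (lebesgue_tuple R M).

Lemma measurable_enorm_ball : measurable (@enorm_ball R M L0).
Proof.
have mE : measurable_fun setT (EFin \o @enorm R M).
  apply/measurable_EFinP; apply: measurableT_comp.
    by apply: continuous_measurable_fun; exact: sqrt_continuous.
  apply: measurable_sum => j; apply: measurable_funX.
  exact: measurable_tnth.
by rewrite -[enorm_ball _]setTI; exact: (emeasurable_fun_infty_c measurableT mE).
Qed.

Lemma unnormalized_q_ge0 (l : M.-tuple R) : 0 <= unnormalized_q tau L0 l.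
Proof.
apply: mulr_ge0; last by rewrite indicE ler0n.
by apply: prodr_ge0 => j _; exact: kernel_tau_ge0.
Qed.

Lemma measurable_unnormalized_q :
  measurable_fun setT (@unnormalized_q R M tau L0).
Proof.
apply: measurable_funM; last first.
  by apply: measurable_indic; exact: measurable_enorm_ball.
apply: (@measurable_prod_tnth _ _ (fun=> kernel_tau tau)) => _.
exact: measurable_kernel_tau.
Qed.

(** Dropping the indicator leaves a product of one-dimensional densities. The same comparison shows
    that the integral is finite, so [fine] keeps its value. *)
Lemma C0_le1 : @C0 R M tau L0 <= 1.
Proof.
have I1 : (\int[leb]_l (unnormalized_q tau L0 l)%:E <= 1)%E.
  apply: (@le_trans _ _ (\int[leb]_l (\prod_(j < M) kernel_tau tau (tnth l j))%:E)%E).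
    apply: ge0_le_integral => //.
    - by move=> l _; rewrite lee_fin; exact: unnormalized_q_ge0.
    - by apply/measurable_EFinP; exact: measurable_unnormalized_q.
    - apply/measurable_EFinP.
      apply: (@measurable_prod_tnth _ _ (fun=> kernel_tau tau)) => _.
      exact: measurable_kernel_tau.
    - move=> l _; rewrite lee_fin ler_piMr//.
      by apply: prodr_ge0 => j _; exact: kernel_tau_ge0.
  rewrite (@integral_prod_lebesgue_tuple _ _ (fun=> kernel_tau tau)).
  - by rewrite big1// => j _; exact: integral_kernel_tau.
  - by move=> _ t; exact: kernel_tau_ge0.
  - by move=> _; exact: measurable_kernel_tau.
have I0 : (0 <= \int[leb]_l (unnormalized_q tau L0 l)%:E)%E.
  by apply: integral_ge0 => l _; rewrite lee_fin; exact: unnormalized_q_ge0.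
rewrite /C0 -lee_fin fineK// ge0_fin_numE//; exact: le_lt_trans I1 (ltry _).
Qed.

Lemma q_ge0 (l : M.-tuple R) : 0 < @C0 R M tau L0 -> 0 <= q tau L0 l.
Proof.
move=> C00; apply: mulr_ge0; last exact: unnormalized_q_ge0.
by rewrite invr_ge0 ltW.
Qed.

Lemma measurable_q : measurable_fun setT (@q R M tau L0).
Proof. by apply: measurable_funM => //; exact: measurable_unnormalized_q. Qed.

(** Inversion sends 0 to 0, so [C0 = 0] would make [q] vanish and [pi] could not have mass 1. *)
Lemma C0_gt0 (pi : probability (M.-tuple R) R) :
  (forall A, measurable A -> pi A = (\int[leb]_(l in A) (q tau L0 l)%:E)%E) ->
  0 < @C0 R M tau L0.
Proof.
move=> piE; rewrite lt_neqAle fine_ge0 ?andbT; last first.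
  by apply: integral_ge0 => l _; rewrite lee_fin; exact: unnormalized_q_ge0.
apply/eqP => C00; have := piE _ measurableT.
rewrite probability_setT integral0_eq; first by move/eqP; rewrite onee_eq0.
by move=> l _; rewrite /q -C00 invr0 mul0r.
Qed.

(** Outside the box some factor on the left is 0. Inside it the indicator in [q] is 1, the kernels
    compare factor by factor, and [C0^-1 >= 1] only enlarges the right side. *)
Lemma prod_shifted_kernel_le (D : set R) (c : R) (lstar l : M.-tuple R) :
  0 < c -> 0 < @C0 R M tau L0 ->
  ((forall j, D `|tnth l j - tnth lstar j|) -> enorm_ball L0 l) ->
  \prod_(j < M) shifted_kernel tau D c (tnth lstar j) (tnth l j) <=
  \prod_(j < M) (c^-1 * (1 + tau^-1 * `|tnth lstar j|) ^+ 4) * q tau L0 l.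
Proof.
move=> c0 C00 Dball.
have posK (j : 'I_M) : 0 < c^-1 * (1 + tau^-1 * `|tnth lstar j|) ^+ 4.
  by rewrite mulr_gt0 ?invr_gt0// exprn_gt0// ltr_pwDl// mulr_ge0// invr_ge0 ltW.
have [/Dball Bl|/existsNP[j nDj]] := pselect (forall j, D `|tnth l j - tnth lstar j|);
  last first.
  rewrite (bigD1 j)//= /shifted_kernel indicE memNset// mulr0 mul0r.
  rewrite mulr_ge0 ?prodr_ge0// => [i _|]; first exact/ltW/posK.
  exact: q_ge0.
apply: (@le_trans _ _ (\prod_(j < M) (c^-1 * (1 + tau^-1 * `|tnth lstar j|) ^+ 4) *
    \prod_(j < M) kernel_tau tau (tnth l j))).
  rewrite -big_split/=; apply: ler_prod => j _; rewrite shifted_kernel_ge0 ?(ltW c0)//=.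
  apply: (@le_trans _ _ (c^-1 * kernel_tau tau (tnth l j - tnth lstar j))).
    rewrite ler_piMr//.
    by rewrite mulr_ge0 ?invr_ge0 ?(ltW c0)//; exact: kernel_tau_ge0.
  by rewrite -mulrA ler_wpM2l ?invr_ge0 ?(ltW c0)// kernel_tau_shift_le.
rewrite ler_wpM2l//; first by apply: prodr_ge0 => j _; exact/ltW/posK.
rewrite /q /unnormalized_q indicE mem_set// mulr1 ler_peMl//.
  by apply: prodr_ge0 => j _; exact: kernel_tau_ge0.
by rewrite invf_ge1// C0_le1.
Qed.

End sparsity_prior_facts.

(** * Bias, variance and divergence of the truncated product law *)

Lemma integral_sqnorm_lincomb (R : realType) (X : Type) (n M : nat)
    (x : n.-tuple X) (f : X -> R) (phi : 'I_M -> X -> R)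
    (a : 'I_M -> R -> R) (m v : 'I_M -> R) :
  (forall j t, 0 <= a j t) -> (forall j, measurable_fun setT (a j)) ->
  (forall j r b, \int[lebesgue_measure]_t ((r + t * b) ^+ 2 * a j t)%:E =
    ((r + m j * b) ^+ 2 + b ^+ 2 * v j)%:E)%E ->
  (\int[lebesgue_tuple R M]_l
     (sqnorm_n x (fun z => lincomb phi l z - f z) *
      \prod_(j < M) a j (tnth l j))%:E =
   (sqnorm_n x (fun z => \sum_(j < M) m j * phi j z - f z)
    + \sum_(j < M) v j * sqnorm_n x (phi j))%:E)%E.
Proof.
move=> a0 ma amv.
(* Each design point contributes one affine square, with [r = - f (tnth x i)] and
   [b j = phi j (tnth x i)]. *)
pose g (i : 'I_n) (l : M.-tuple R) :=
  (- f (tnth x i) + \sum_(j < M) tnth l j * phi j (tnth x i)) ^+ 2 *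
  \prod_(j < M) a j (tnth l j).
have g0 i l : 0 <= g i l by rewrite mulr_ge0 ?sqr_ge0// prodr_ge0.
have mg i : measurable_fun setT (g i).
  apply: measurable_funM; first exact: measurable_sqr_affine.
  exact: (@measurable_prod_tnth _ _ a).
transitivity (\int[lebesgue_tuple R M]_l
    ((n%:R^-1)%:E * \sum_(i < n) (g i l)%:E))%E.
  apply: eq_integral => l _; rewrite sumEFin -EFinM; congr EFin.
  rewrite /sqnorm_n -mulrA mulr_suml; congr (_ * _).
  by apply: eq_bigr => i _; rewrite /g /lincomb (addrC (- _)).
rewrite ge0_integralZl//; last 2 first.
- by apply: emeasurable_sum => i; apply/measurable_EFinP; exact: mg.
- by move=> l _; apply: sume_ge0 => i _; rewrite lee_fin.
rewrite ge0_integral_sum//; last 2 first.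
- by move=> i; apply/measurable_EFinP; exact: mg.
- by move=> i l _; rewrite lee_fin.
under eq_bigr do rewrite (integral_sqr_affine_prod _ _ a m v a0 ma amv).
rewrite sumEFin -EFinM; congr EFin.
rewrite big_split/= mulrDr; congr (_ + _).
  rewrite /sqnorm_n; congr (_ * _).
  by apply: eq_bigr => i _; rewrite addrC.
rewrite exchange_big mulr_sumr; apply: eq_bigr => j _.
by rewrite /sqnorm_n mulrCA -mulr_suml (mulrC (v j)).
Qed.

(** Leaving [D], [c] and [v] open covers a bounded edge and a full line by one argument; [rho]
    stands for the risk. *)
Lemma box_oracle_bound (R : realType) (X : Type) (n M : nat) (n_gt0 : (0 < n)%N)
    (x : n.-tuple X) (f : X -> R) (phi : 'I_M -> X -> R)
    (L0 : \bar R) (tau : R) (tau_gt0 : 0 < tau) (beta : R) (beta_gt0 : 0 < beta)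
    (Lambda : set (M.-tuple R)) (mLambda : measurable Lambda)
    (ball_Lambda : enorm_ball L0 `<=` Lambda)
    (pi : probability (M.-tuple R) R)
    (pi_density : forall A, measurable A ->
      pi A = (\int[lebesgue_tuple R M]_(l in A) (q tau L0 l)%:E)%E)
    (rho : \bar R)
    (rho_bound : forall p : probability (M.-tuple R) R, p Lambda = 1%E ->
      (rho <=
         \int[p]_(l in Lambda) (sqnorm_n x (fun z => lincomb phi l z - f z))%:E
         + beta%:E * KL p pi / (n%:R)%:E)%E)
    (lstar : M.-tuple R) (D : set R) (c v : R) :
  measurable D -> D `<=` `[0, +oo[%classic -> 0 < c <= 1 ->
  (forall A B : R, (\int[lebesgue_measure]_(u in D)
     (((A + u * B) ^+ 2 + (A - u * B) ^+ 2) * kernel_tau tau u)%:E =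
     (c * A ^+ 2 + B ^+ 2 * v)%:E)%E) ->
  (forall l : M.-tuple R,
    (forall j, D `|tnth l j - tnth lstar j|) -> enorm_ball L0 l) ->
  (rho <= (sqnorm_n x (fun z => lincomb phi lstar z - f z)
     + v / c * \sum_(j < M) sqnorm_n x (phi j)
     + beta / n%:R *
       \sum_(j < M) (4 * ln (1 + tau^-1 * `|tnth lstar j|) - ln c))%:E)%E.
Proof.
move=> mD Dge0 /andP[c0 c1] HD Dball.
pose a (j : 'I_M) := shifted_kernel tau D c (tnth lstar j).
have a0 j t : 0 <= a j t by apply: shifted_kernel_ge0 => //; exact: ltW.
have ma j : measurable_fun setT (a j) by exact: measurable_shifted_kernel.
have amv (j : 'I_M) (r b : R) :
    (\int[lebesgue_measure]_t ((r + t * b) ^+ 2 * a j t)%:E =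
     ((r + tnth lstar j * b) ^+ 2 + b ^+ 2 * (v / c))%:E)%E.
  exact: integral_sqr_shifted_kernel.
pose h (l : M.-tuple R) := \prod_(j < M) a j (tnth l j).
have h0 l : 0 <= h l by exact: prodr_ge0.
have mh : measurable_fun setT h by exact: (@measurable_prod_tnth _ _ a).
have h1 : (\int[lebesgue_tuple R M]_l (h l)%:E = 1)%E.
  rewrite (@integral_prod_lebesgue_tuple _ _ a)// big1// => j _.
  have := amv j 1 0.
  under eq_integral do rewrite mulr0 addr0 expr1n mul1r.
  by move=> ->; rewrite mulr0 addr0 expr0n mul0r expr1n addr0.
have C00 := C0_gt0 _ _ tau_gt0 _ pi_density.
pose K := \prod_(j < M) (c^-1 * (1 + tau^-1 * `|tnth lstar j|) ^+ 4).
have hK l : h l <= K * q tau L0 l.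
  by apply: prod_shifted_kernel_le => // /Dball.
have [p pE] := density_probability _ _ _ _ _ h0 mh h1.
have hball l : ~ enorm_ball L0 l -> h l = 0.
  move=> nBl; have [/Dball//|/existsNP[j nDj]] :=
    pselect (forall j, D `|tnth l j - tnth lstar j|).
  by rewrite /h (bigD1 j)//= /a /shifted_kernel indicE memNset// mulr0 mul0r.
(* The density vanishes off the ball, which [Lambda] contains, so restricting to [Lambda] loses no
   mass. *)
have pLambda : p Lambda = 1%E.
  rewrite pE// integral_mkcond -h1; apply: eq_integral => l _.
  rewrite patchE; case: ifPn => // /negP lL /=.
  by rewrite hball// => /ball_Lambda /mem_set.
have fac_ge1 (j : 'I_M) : 1 <= 1 + tau^-1 * `|tnth lstar j|.
  by rewrite lerDl mulr_ge0// invr_ge0 ltW.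
have K1 : 1 <= K.
  apply: (big_ind (fun y => 1 <= y)) => // [y z y1 z1|j _]; apply: mulr_ege1 => //.
    by rewrite invf_ge1.
  exact: exprn_ege1.
have lnK : ln K = \sum_(j < M) (4 * ln (1 + tau^-1 * `|tnth lstar j|) - ln c).
  rewrite /K ln_prod => [|j]; last first.
    by rewrite mulr_gt0 ?invr_gt0 ?exprn_gt0// (lt_le_trans _ (fac_ge1 j)).
  apply: eq_bigr => j _; have fj := lt_le_trans ltr01 (fac_ge1 j).
  by rewrite lnM ?posrE ?invr_gt0 ?exprn_gt0// lnV ?posrE// lnXn// addrC mulr_natl.
have KLp : (KL p pi <= (ln K)%:E)%E.
  apply: KL_le_ln => // A mA; rewrite pE// pi_density//.
  have mq : measurable_fun A (EFin \o q tau L0).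
    by apply/measurable_EFinP; apply: measurable_funTS; exact: measurable_q.
  have q0 (l : M.-tuple R) : 0 <= q tau L0 l by exact: q_ge0.
  rewrite -ge0_integralZl//; last 2 first.
  - by move=> l _; rewrite lee_fin.
  - by rewrite lee_fin (le_trans _ K1).
  apply: ge0_le_integral => //.
  - by move=> l _; rewrite lee_fin.
  - exact/measurable_EFinP/measurable_funTS.
  - by apply: emeasurable_funM.
  - by move=> l _; rewrite -EFinM lee_fin.
apply: (le_trans (rho_bound p pLambda)).
rewrite EFinD; apply: leeD.
  pose F (l : M.-tuple R) := sqnorm_n x (fun z => lincomb phi l z - f z).
  have F0 l : 0 <= F l.
    by rewrite mulr_ge0 ?invr_ge0// sumr_ge0// => i _; exact: sqr_ge0.
  have mF : measurable_fun setT F.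
    apply: measurable_funM => //; apply: measurable_sum => i.
    rewrite (_ : (fun l => _) = fun l : M.-tuple R =>
        (- f (tnth x i) + \sum_(j < M) tnth l j * phi j (tnth x i)) ^+ 2).
      exact: measurable_sqr_affine.
    by apply/funext => l; rewrite addrC.
  (* Since [F] is nonnegative the domain may grow to the whole space, where the product formula is
     exact. *)
  apply: (@le_trans _ _ (\int[p]_l (F l)%:E)%E).
    apply: ge0_subset_integral => //; first exact/measurable_EFinP.
    by move=> l _; rewrite lee_fin; exact: F0.
  rewrite (ge0_integral_density _ _ _ _ _ _ _ h0 mh pE)//.
  rewrite (integral_sqnorm_lincomb _ _ _ _ _ _ _ a _ _ a0 ma amv).
  by rewrite mulr_sumr.
rewrite -lnK inver pnatr_eq0 -[n == 0%N]negbK -lt0n n_gt0/=.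
rewrite (_ : beta / n%:R * ln K = beta * ln K * n%:R^-1); last by rewrite mulrAC.
rewrite !EFinM lee_wpmul2r//.
by rewrite lee_wpmul2l// lee_fin ltW.
Qed.

(** * Elementary inequalities for the box and its mass *)

Lemma opp_ln_onem_le (R : realType) (y : R) : 0 <= y <= 2^-1 ->
  - ln (1 - y) <= 2 * y.
Proof.
move=> /andP[y0 y1].
have y1' : 0 < 1 - y by lra.
(* The bound [ln (1 + z) <= z] is used at [z = y / (1 - y)], and [1 - y >= 1 / 2] finishes. *)
have -> : - ln (1 - y) = ln (1 + y / (1 - y)).
  by rewrite -lnV ?posrE//; congr ln; field; rewrite gt_eqF.
apply: (le_trans (le_ln1Dx _)).
  by rewrite (lt_le_trans (ltrN10 _))// divr_ge0// ltW.
rewrite ler_pdivrMr//; nra.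
Qed.

(** The half edge keeps the box within distance [delta * r] of [lstar], and the norm of [lstar]
    leaves exactly that much room. *)
Lemma enorm_le_of_box (R : realType) (M : nat) (lstar l : M.-tuple R)
    (r delta : R) : (0 < M)%N -> 0 < r -> 0 < delta < 1 ->
  enorm lstar <= (1 - delta) * r ->
  (forall j, `|tnth l j - tnth lstar j| <= delta * r / Num.sqrt M%:R) ->
  enorm l <= r.
Proof.
move=> M0 r0 /andP[d0 d1] lstarr lr.
have d1' : 0 < 1 - delta by rewrite subr_gt0.
have M0' : 0 < M%:R :> R by rewrite ltr0n.
have sum0 (t : M.-tuple R) : 0 <= \sum_(j < M) tnth t j ^+ 2.
  by apply: sumr_ge0 => j _; exact: sqr_ge0.
have sqlstar : \sum_(j < M) tnth lstar j ^+ 2 <= ((1 - delta) * r) ^+ 2.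
  rewrite -(sqr_sqrtr (sum0 lstar)) lerXn2r ?nnegrE ?sqrtr_ge0//.
  by rewrite mulr_ge0 ?(ltW d1') ?(ltW r0).
have sqdiff : \sum_(j < M) (tnth l j - tnth lstar j) ^+ 2 <= (delta * r) ^+ 2.
  apply: (@le_trans _ _ (\sum_(j < M) (delta * r) ^+ 2 / M%:R)).
    apply: ler_sum => j _; rewrite -[in leRHS](@sqr_sqrtr _ M%:R) ?ler0n//.
    rewrite -expr_div_n -real_normK ?num_real// lerXn2r ?nnegrE//.
    by rewrite divr_ge0 ?sqrtr_ge0// mulr_ge0 ?(ltW d0) ?(ltW r0).
  by rewrite sumr_const card_ord -[leLHS]mulr_natr divfK// gt_eqF.
rewrite /enorm -(ger0_norm (ltW r0)) -sqrtr_sqr ler_wsqrtr//.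
(* convexity of the square: ((x - y) + y)^2 <= (x - y)^2 / delta + y^2 / (1 - delta) *)
apply: (@le_trans _ _ (\sum_(j < M) ((tnth l j - tnth lstar j) ^+ 2 / delta +
    tnth lstar j ^+ 2 / (1 - delta)))).
  apply: ler_sum => j _; rewrite -subr_ge0.
  set x := tnth l j; set y := tnth lstar j.
  have -> : (x - y) ^+ 2 / delta + y ^+ 2 / (1 - delta) - x ^+ 2 =
     ((1 - delta) * (x - y) - delta * y) ^+ 2 / (delta * (1 - delta)).
    by field; rewrite !gt_eqF.
  by rewrite divr_ge0 ?sqr_ge0// mulr_ge0// ltW.
rewrite big_split/= -!mulr_suml.
have -> : r ^+ 2 = (delta * r) ^+ 2 / delta + ((1 - delta) * r) ^+ 2 / (1 - delta).
  by field; rewrite !gt_eqF.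
by apply: lerD; rewrite ler_wpM2r// invr_ge0 ltW.
Qed.

Lemma sum_support_ln (R : realType) (M : nat) (tau a : R)
    (lstar : M.-tuple R) :
  \sum_(j < M) a * ln (1 + tau^-1 * `|tnth lstar j|) =
  a * \sum_(j < M | tnth lstar j != 0) ln (1 + tau^-1 * `|tnth lstar j|).
Proof.
rewrite mulr_sumr [RHS]big_mkcond; apply: eq_bigr => j _.
by case: eqP => [->|//]; rewrite normr0 mulr0 addr0 ln1 mulr0.
Qed.

(** The half edge carries a factor [1 / sqrt M], whose inverse cube gives [sqrt M ^+ 3]; the sum
    over [M] coordinates supplies the other factor. *)
Lemma powR_5div2 (R : realType) (a : R) : 0 <= a ->
  a `^ (5 / 2) = a * Num.sqrt a ^+ 3.
Proof.
move=> a0; rewrite mulrC powRrM powR12_sqrt// -[5]/(5%:R) powR_mulrn ?sqrtr_ge0//.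
by rewrite (exprD _ 2 3) sqr_sqrtr.
Qed.

(** From [tau <= S] the ratio is at most 1/2 and its cube at most 1/8, within reach of
    [opp_ln_onem_le]; dropping [tau] from the denominator then enlarges the ratio. *)
Lemma opp_ln_box_mass_le (R : realType) (M : nat) (tau S : R) :
  0 < tau -> tau <= S ->
  - ln (1 - (tau / (tau + S)) ^+ 3) <= 2 * (tau / S) ^+ 3.
Proof.
move=> t0 tS; have S0 := lt_le_trans t0 tS; have tS0 := addr_gt0 t0 S0.
have w0 : 0 <= tau / (tau + S) by rewrite divr_ge0// ltW.
apply: (@le_trans _ _ (2 * (tau / (tau + S)) ^+ 3)).
  apply: opp_ln_onem_le; rewrite exprn_ge0//=.
  have : tau / (tau + S) <= 2^-1 by rewrite ler_pdivrMr//; lra.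
  move: (tau / (tau + S)) w0 => w w0 w2.
  have : w ^+ 3 <= 2^-1 ^+ 3 by rewrite lerXn2r ?nnegrE// invr_ge0.
  lra.
rewrite ler_wpM2l// lerXn2r ?nnegrE ?divr_ge0 ?(ltW t0) ?(ltW S0) ?(ltW tS0)//.
by rewrite ler_wpM2l ?(ltW t0)// lef_pV2 ?posrE// lerDr ltW.
Qed.

(** * Choice of the edge for infinite and for finite [L0] *)

Theorem theorem5 (R : realType) (X : Type) (n M : nat) (n_gt0 : (0 < n)%N)
    (M_gt0 : (0 < M)%N)
    (d : measure_display) (Omega : measurableType d) (P : probability Omega R)
    (x : n.-tuple X) (f : X -> R)
    (xi : 'I_n -> {RV P >-> R})
    (xi_indep : mutually_independent xi)
    (xi_ident : identically_distributed xi)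
    (xi_mean0 : forall i, zero_mean (xi i))
    (phi : 'I_M -> X -> R)
    (L0 : \bar R) (L0_gt0 : (0 < L0)%E)
    (delta : R) (delta_gt0 : 0 < delta) (delta_lt1 : delta < 1)
    (tau : R) (tau_gt0 : 0 < tau)
    (tau_le : (tau%:E <= delta%:E * L0 / (Num.sqrt M%:R)%:E)%E)
    (beta : R) (beta_gt0 : 0 < beta)
    (Lambda : set (M.-tuple R)) (mLambda : measurable Lambda)
    (ball_Lambda : enorm_ball L0 `<=` Lambda)
    (pi : probability (M.-tuple R) R)
    (pi_density : forall A, measurable A ->
      pi A = (\int[lebesgue_tuple R M]_(l in A) (q tau L0 l)%:E)%E)
    (fhat : n.-tuple X -> n.-tuple R -> X -> R)
    (fhat_estimator : is_estimator x fhat)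
    (risk_bound : forall p : probability (M.-tuple R) R, p Lambda = 1%E ->
      (risk x f xi fhat <=
         \int[p]_(l in Lambda) (sqnorm_n x (fun z => lincomb phi l z - f z))%:E
         + beta%:E * KL p pi / (n%:R)%:E)%E) :
  forall lstar : M.-tuple R,
    ((enorm lstar)%:E <= (1 - delta)%:E * L0)%E ->
    (risk x f xi fhat <=
       (sqnorm_n x (fun z => lincomb phi lstar z - f z)
        + 4 * beta / n%:R *
            \sum_(j < M | tnth lstar j != 0) ln (1 + tau^-1 * `|tnth lstar j|)
        + remainder x phi beta tau L0 delta)%:E)%E.
Proof.
move=> lstar lstar_le.
have S_ge0 : 0 <= \sum_(j < M) sqnorm_n x (phi j).
  apply: sumr_ge0 => j _; rewrite mulr_ge0 ?invr_ge0// sumr_ge0// => i _.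
  exact: sqr_ge0.
have n0 : 0 < n%:R :> R by rewrite ltr0n.
have bound (D : set R) (c v : R) := @box_oracle_bound R X n M n_gt0 x f phi L0
  tau tau_gt0 beta beta_gt0 Lambda mLambda ball_Lambda pi pi_density
  (risk x f xi fhat) risk_bound lstar D c v.
move: L0 L0_gt0 tau_le ball_Lambda pi_density lstar_le bound => [r||]// + + _ _;
  last first.
  (* For infinite [L0] nothing is cut off: the mass is 1, so [ln c = 0], and the variance is exactly
     [tau ^+ 2]. *)
  move=> _ _ _ /(_ `[0, +oo[%classic 1 (tau ^+ 2)) bound.
  apply: (le_trans (bound _ _ _ _ _)) => //.
  - by rewrite ltr01 lexx.
  - by move=> A B; rewrite integral_kernel_tau_pinfty// mul1r.
  - by move=> l _; rewrite /enorm_ball/= leey.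
  rewrite lee_fin /remainder divr1 ln1 oppr0.
  rewrite big_split/= big1_eq addr0 sum_support_ln.
  by rewrite mulrA (mulrC _ 4) mulrA addrAC.
rewrite lte_fin => r0 tau_le lstar_le bound.
pose s : R := Num.sqrt M%:R.
have s0 : 0 < s by rewrite sqrtr_gt0 ltr0n.
have s2 : s ^+ 2 = M%:R by rewrite sqr_sqrtr.
pose S := delta * r / s.
have tauS : tau <= S.
  by move: tau_le; rewrite inver (gt_eqF s0) -!EFinM lee_fin.
have S0 : 0 < S by exact: lt_le_trans tauS.
have tS0 : 0 < tau + S by rewrite addr_gt0.
(* [c] and [v] are the mass and the unnormalised second moment of the kernel on [[-S, S]], read off
   [integral_kernel_tau_itv]. *)
pose c := 1 - (tau / (tau + S)) ^+ 3.
pose v := tau ^+ 2 * (S / (tau + S)) ^+ 3.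
have c0 : 0 < c.
  rewrite subr_gt0 exprn_ilt1// ?divr_ge0 ?(ltW tau_gt0) ?(ltW tS0)//.
  by rewrite ltr_pdivrMr// mul1r ltrDl.
have c1 : c <= 1.
  by rewrite gerDl oppr_le0 exprn_ge0// divr_ge0// ltW.
apply: (le_trans (bound `[0, S]%classic c v _ _ _ _ _)) => //.
- by move=> u /=; rewrite !in_itv/= andbT => /andP[].
- by rewrite c0.
- by move=> A B; rewrite integral_kernel_tau_itv.
- move=> l lD; rewrite /enorm_ball/= lee_fin.
  apply: (@enorm_le_of_box _ _ lstar _ _ delta) => //.
  + by rewrite delta_gt0.
  + by move=> j; have := lD j; rewrite /= in_itv/= => /andP[].
(* [E] is the exponent in the remainder and equals [M] times the bound on [- ln c]; it controls both
   the variance inflation [c^-1] and the total divergence cost of truncation. *)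
pose E := 2 * tau ^+ 3 * M%:R `^ (5 / 2) * ((delta * r) ^+ 3)^-1.
have EE : E = M%:R * (2 * (tau / S) ^+ 3).
  rewrite /E powR_5div2// -/s /S; field.
  by rewrite !gt_eqF.
have lnc : - ln c <= 2 * (tau / S) ^+ 3 by exact: opp_ln_box_mass_le.
(* A single coordinate costs at most [E / M], and [M >= 1]. *)
have lnE : - ln c <= E.
  apply: (le_trans lnc); rewrite EE ler_peMl// ?ler1n//.
  by rewrite mulr_ge0// exprn_ge0// divr_ge0// ltW.
have invc : c^-1 <= expR E.
  by rewrite -[leLHS]lnK ?posrE ?invr_gt0// lnV ?posrE// ler_expR.
have v_le : v <= tau ^+ 2.
  apply: ler_piMr; first exact: sqr_ge0.
  apply: exprn_ile1; first by rewrite divr_ge0// ltW.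
  by rewrite ler_pdivrMr// mul1r lerDr ltW.
rewrite lee_fin big_split/= sumr_const card_ord sum_support_ln.
rewrite /remainder -/E.
have -> : 2 * beta * tau ^+ 3 * M%:R `^ (5 / 2) / (n%:R * delta ^+ 3 * r ^+ 3) =
    beta / n%:R * E.
  by rewrite /E; field; rewrite !gt_eqF.
have t1 : v / c * \sum_(j < M) sqnorm_n x (phi j) <=
    tau ^+ 2 * expR E * \sum_(j < M) sqnorm_n x (phi j).
  rewrite ler_wpM2r// ler_pM// ?invr_ge0 ?(ltW c0)//.
  by rewrite mulr_ge0 ?sqr_ge0// exprn_ge0// divr_ge0// ltW.
have t2 : beta / n%:R * (- ln c *+ M) <= beta / n%:R * E.
  rewrite ler_wpM2l ?divr_ge0 ?(ltW beta_gt0) ?(ltW n0)//.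
  by rewrite EE -[leLHS]mulr_natl ler_wpM2l.
rewrite mulrDr (mulrA (beta / _)) (mulrC (beta / _) 4) (mulrA 4).
lra.
Qed.
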